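(* Let $\langle N,M_0\rangle$ be a bounded marked net with basis partition $\pi=(T_E,T_I)$, and let $\mathcal{M}_{B_M}$ be its set of minimax basis markings. A marking $M\in R(N,M_0)$ is dead if and only if there exist $M_b\in\mathcal{M}_{B_M}$ and $\sigma\in\Sigma_{I,\max}(M_b)$ such that $\sigma\notin\Sigma_{\max}(M_b,t)$ for all $t\in T_E$, and $M_b[\sigma\rangle M$.
   Context: **Petri nets.** A Petri net is $N=(P,T,Pre,Post)$ with a finite set $P$ of $m$ places, a finite set $T$ of transitions, and functions $Pre,Post:P\times T\to\mathbb{N}$ ($\mathbb{N}=\{0,1,2,\dots\}$); $C=Post-Pre$, and $A(\cdot,t)$ is the column of a matrix $A$ at $t$. A marking is a vector $M\in\mathbb{N}^m$. Transition $t$ is enabled at $M$ if $M\ge Pre(\cdot,t)$ componentwise, and its firing yields $M'=M+C(\cdot,t)$, written $M[t\rangle M'$. This extends to finite sequences $\sigma\in T^*$ (with $M[\varepsilon\rangle M$ for the empty sequence): $M[\sigma\rangle M'$; $M[\sigma\rangle$ means $\sigma$ can be fired at $M$. $R(N,M)$ is the set of markings reachable from $M$. A marked net is a pair $\langle N,M_0\rangle$ with initial marking $M_0$; it is bounded if there is $k\in\mathbb{N}$ with $M(p)\le k$ for all $M\in R(N,M_0)$, $p\in P$. A marking is dead if no transition is enabled at it. **Basis partitions.** A basis partition is a pair $\pi=(T_E,T_I)$ with $T=T_E\cup T_I$ disjoint (explicit and implicit transitions) such that the $T_I$-induced sub-net (same places, only the transitions in $T_I$, with $Pre,Post$ restricted)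 has no directed cycle in its underlying digraph (arcs $p\to t$ when $Pre(p,t)>0$, $t\to p$ when $Post(p,t)>0$). Let $n_I=|T_I|$ and let $C_I$ be the incidence matrix of this sub-net. For $\sigma\in T_I^*$, $\varphi(\sigma)\in\mathbb{N}^{n_I}$ is the vector counting occurrences of each transition in $\sigma$. **Explanations.** For a marking $M$ and $t\in T_E$: $\Sigma(M,t)=\{\sigma\in T_I^*\mid M[\sigma\rangle M',\ M'\ge Pre(\cdot,t)\}$; $\Sigma_{\min}(M,t)$ (resp. $\Sigma_{\max}(M,t)$) is the set of $\sigma\in\Sigma(M,t)$ for which there is no $\sigma'\in\Sigma(M,t)$ with $\varphi(\sigma')\le\varphi(\sigma)$ (resp. $\ge$) componentwise and $\varphi(\sigma')\neq\varphi(\sigma)$; $Y_{\min}(M,t)=\varphi(\Sigma_{\min}(M,t))$, $Y_{\max}(M,t)=\varphi(\Sigma_{\max}(M,t))$. **Minimax basis markings.** The set $\mathcal{M}_{B_M}$ of minimax basis markings is the smallest set such that $M_0\in\mathcal{M}_{B_M}$, and whenever $M\in\mathcal{M}_{B_M}$, $t\in T_E$ and $\mathbf{y}\in Y_{\min}(M,t)\cup Y_{\max}(M,t)$, then $M+C_I\mathbf{y}+C(\cdot,t)\in\mathcal{M}_{B_M}$. **Maximal implicit firing sequences.** For $M\in R(N,M_0)$, $\Sigma_{I,\max}(M)$ is the set of $\sigma\in T_I^*$ such that $M[\sigma\rangle$ and there is no $\sigma'\in T_I^*$ with $M[\sigma'\rangle$, $\varphi(\sigma')\ge\varphi(\sigma)$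 componentwise and $\varphi(\sigma')\ne\varphi(\sigma)$. *)

(* Defs.v *)
From mathcomp Require Import all_boot all_order all_algebra.

Set Implicit Arguments.
Unset Strict Implicit.
Unset Printing Implicit Defensive.

Local Open Scope ring_scope.

Record petri_net (P T : finType) := PetriNet {
  Pre : P -> T -> nat;
  Post : P -> T -> nat
}.

Definition vle (I : finType) (x y : {ffun I -> nat}) : bool :=
  [forall i, (x i <= y i)%N].

Section Nets.
Variables (P T : finType) (N : petri_net P T).

Definition marking := {ffun P -> nat}.

Definition incidence (p : P) (t : T) : int := (Post N p t)%:Z - (Pre N p t)%:Z.

Definition enabled (M : marking) (t : T) : bool := vle [ffun p => Pre N p t] M.

Definition fires1 (M : marking) (t : T) (M' : marking) : Prop :=
  enabled M t /\ forall p, (M' p)%:Z = (M p)%:Z + incidence p t.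

Fixpoint fires (M : marking) (s : seq T) (M' : marking) : Prop :=
  if s is t :: s' then exists M1, fires1 M t M1 /\ fires M1 s' M' else M' = M.

Definition fireable (M : marking) (s : seq T) : Prop := exists M', fires M s M'.

Definition reachable (M M' : marking) : Prop := exists s, fires M s M'.

Definition bounded (M0 : marking) : Prop :=
  exists k : nat, forall M, reachable M0 M -> forall p, (M p <= k)%N.

Definition dead (M : marking) : Prop := forall t, ~~ enabled M t.

Definition arc : rel (P + T) := fun u v =>
  match u, v with
  | inl p, inr t => (0 < Pre N p t)%N
  | inr t, inl p => (0 < Post N p t)%N
  | _, _ => false
  end.

Definition acyclic : Prop := forall c : seq (P + T), ucycle arc c -> c = [::].

End Nets.

Definition induced_subnet (P T : finType) (N : petri_net P T) (TI : {set T}) :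
    petri_net P {t : T | t \in TI} :=
  PetriNet (fun p t => Pre N p (val t)) (fun p t => Post N p (val t)).

Definition basis_partition (P T : finType) (N : petri_net P T)
    (TE TI : {set T}) : Prop :=
  [/\ TE :|: TI = [set: T], [disjoint TE & TI] & acyclic (induced_subnet N TI)].

(* Words of implicit transitions are sequences over the subtype
   {t | t \in TI}; they are fired in N itself, through [map val]. *)
Section Explanations.
Variables (P T : finType) (N : petri_net P T) (TE TI : {set T}).
Local Notation marking := (marking P).
Local Notation implicit := {t : T | t \in TI}.

Definition phi (s : seq implicit) : {ffun implicit -> nat} :=
  [ffun t => count_mem t s].

Definition Sigma (M : marking) (t : T) (s : seq implicit) : Prop :=
  exists M', fires N M (map val s) M' /\ vle [ffun p => Pre N p t] M'.

Definition Sigma_min (M : marking) (t : T) (s : seq implicit) : Prop :=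
  Sigma M t s /\
  ~ exists s', [/\ Sigma M t s', vle (phi s') (phi s) & phi s' <> phi s].

Definition Sigma_max (M : marking) (t : T) (s : seq implicit) : Prop :=
  Sigma M t s /\
  ~ exists s', [/\ Sigma M t s', vle (phi s) (phi s') & phi s' <> phi s].

Definition Y_min (M : marking) (t : T) (y : {ffun implicit -> nat}) : Prop :=
  exists s, Sigma_min M t s /\ y = phi s.

Definition Y_max (M : marking) (t : T) (y : {ffun implicit -> nat}) : Prop :=
  exists s, Sigma_max M t s /\ y = phi s.

(* The marking equation is read in int; the integer vector on its right-hand
   side is nonnegative whenever y is in Y_min M t or Y_max M t, so requiring
   M' to be a vector of naturals excludes nothing. *)
Inductive minimax_basis_marking (M0 : marking) :
    marking -> Prop :=
| minimax_init : minimax_basis_marking M0 M0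
| minimax_step (M : marking) (t : T) (y : {ffun implicit -> nat})
    (M' : marking) :
    minimax_basis_marking M0 M -> t \in TE ->
    Y_min M t y \/ Y_max M t y ->
    (forall p, (M' p)%:Z = (M p)%:Z
       + \sum_(u : implicit) incidence (induced_subnet N TI) p u * (y u)%:Z
       + incidence N p t) ->
    minimax_basis_marking M0 M'.

Definition Sigma_I_max (M : marking) (s : seq implicit) : Prop :=
  fireable N M (map val s) /\
  ~ exists s' : seq implicit,
      [/\ fireable N M (map val s'), vle (phi s) (phi s') & phi s' <> phi s].

End Explanations.

(* Main.v *)
Require Import Defs.
From mathcomp Require Import all_boot all_order all_algebra.
From mathcomp Require Import zify.
From Stdlib Require Import Classical_Prop.

(** Acyclicity of the implicit sub-net makes its state equation exact: if
    [M + C_I y] is nonnegative, then some implicit word with count vector [y]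
    fires at [M], since otherwise every transition in the support of [y] would
    wait for a token that only another transition of the support can produce,
    which yields a directed cycle.  Two consequences give the equivalence.
    First, a firing sequence from [M0] can be rearranged so that each explicit
    transition is preceded only by a minimal explanation, the other implicit
    firings being postponed; thus every reachable marking is reached by an
    implicit word from a minimax basis marking.  Second, if such a word leads to
    a dead marking then it is maximal, because a larger word would leave a
    nonzero residual vector, hence an implicit transition enabled at that
    marking. *)

Set Implicit Arguments.
Unset Strict Implicit.
Unset Printing Implicit Defensive.

Import GRing.Theory.
Local Open Scope ring_scope.

Lemma ucycle_free_source (V : finType) (e : rel V) (S : {set V}) (x0 : V) :
  (forall c, ucycle e c -> c = [::]) -> x0 \in S ->
  exists2 x, x \in S & forall z, z \in S -> ~~ e z x.
Proof.
move=> acyc Sx0.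
(* Choose x with the most descendants: a predecessor z of x in S has no more,
   so x reaches z. *)
case: (arg_maxnP (fun x => #|connect e x|) Sx0) => x Sx xmax.
exists x => // z Sz; apply/negP => ezx.
have sub : connect e x \subset connect e z.
  by apply/subsetP => w; apply: connect_trans (connect1 ezx).
have xz : connect e x z.
  have /subset_cardP/(_ sub) eqc : #|connect e x| = #|connect e z|.
    by apply/eqP; rewrite eqn_leq subset_leq_card //=; apply: xmax.
  by have := connect0 e z; rewrite -[connect e z z]/(z \in connect e z) -eqc.
case/connectP: xz => p pth zE; move: ezx; rewrite {}zE.
(* [ucycle] forbids repeated vertices, so the path from [x] to [z] is made simple before the edge
   back to [x] closes it. *)
case/shortenP: pth => q qpth uq _ ezx.
have /acyc // : ucycle e (x :: q).
by rewrite /ucycle /cycle rcons_path qpth ezx.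
Qed.

Lemma vle_sum (I : finType) (x y : {ffun I -> nat}) :
  vle x y -> x <> y -> (\sum_i x i < \sum_i y i)%N.
Proof.
move=> /forallP lexy neq.
have [i neqi] : exists i, x i != y i.
  by apply/existsP; apply: contraPT neq; rewrite negb_exists => /forallP h;
     apply; apply/ffunP => i; apply/eqP; have := h i; rewrite negbK.
rewrite (bigD1 i) //= [in X in (_ < X)%N](bigD1 i) //= -addSn leq_add //.
  by rewrite ltn_neqAle neqi lexy.
by apply: leq_sum.
Qed.

Lemma vle_trans (I : finType) (y x z : {ffun I -> nat}) :
  vle x y -> vle y z -> vle x z.
Proof.
move=> /forallP xy /forallP yz.
by apply/forallP => i; apply: leq_trans (yz i).
Qed.

Lemma vle_refl (I : finType) (x : {ffun I -> nat}) : vle x x.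
Proof. by apply/forallP. Qed.

Section Firing.
Variables (P T : finType) (N : petri_net P T).

Lemma fires_cat (M M' : marking P) (s1 s2 : seq T) :
  fires N M (s1 ++ s2) M' <->
  exists M1, fires N M s1 M1 /\ fires N M1 s2 M'.
Proof.
elim: s1 M => [|t s1 IH] M /=.
  by split=> [h|[M1 [-> h]]] //; exists M.
split=> [[M2 [h1 /IH [M1 [h2 h3]]]]|[M1 [[M2 [h1 h2]] h3]]].
  by exists M1; split=> //; exists M2.
by exists M2; split=> //; apply/IH; exists M1.
Qed.

Lemma fires_rcons (M M' : marking P) (s : seq T) (t : T) :
  fires N M (rcons s t) M' <->
  exists M1, fires N M s M1 /\ fires1 N M1 t M'.
Proof.
rewrite -cats1 fires_cat; split=> -[M1 [h1]] /=.
  by case=> M2 [h2 ->]; exists M1.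
by move=> h2; exists M1; split=> //; exists M'.
Qed.

Lemma enabled_fires1 (M : marking P) (t : T) :
  enabled N M t -> exists M', fires1 N M t M'.
Proof.
move=> en; exists [ffun p => (M p - Pre N p t + Post N p t)%N]; split=> // p.
by have /forallP/(_ p) := en; rewrite !ffunE /incidence; lia.
Qed.

End Firing.

Section Implicit.
Variables (P T : finType) (N : petri_net P T) (TI : {set T}).
Local Notation implicit := {t : T | t \in TI}.
Local Notation CI := (incidence (induced_subnet N TI)).

Definition state_eq (M : marking P) (y : {ffun implicit -> nat})
    (M' : marking P) : Prop :=
  forall p, (M' p)%:Z = (M p)%:Z + \sum_u CI p u * (y u)%:Z.

Lemma sum_phi (s : seq implicit) : (\sum_u phi s u)%N = size s.
Proof.
elim: s => [|t s IH] /=; first by rewrite big1 // => u _; rewrite ffunE.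
rewrite -IH (bigD1 t) //= [in RHS](bigD1 t) //= !ffunE /= eqxx add1n addSn.
congr (_ + _).+1; apply: eq_bigr => u /negbTE ut.
by rewrite !ffunE /= eq_sym ut.
Qed.

Lemma sum_indicator (f : implicit -> int) (t : implicit) :
  \sum_u f u * (t == u)%:Z = f t.
Proof.
rewrite (bigD1 t) //= eqxx mulr1 big1 ?addr0 // => u /negbTE ut.
by rewrite eq_sym ut mulr0.
Qed.

Lemma fires_state_eq (M M' : marking P) (s : seq implicit) :
  fires N M (map val s) M' -> state_eq M (phi s) M'.
Proof.
elim: s M => [|t s IH] M /=.
  by move=> -> p; rewrite big1 ?addr0 // => u _; rewrite ffunE mulr0.
case=> M1 [[_ hM1] /IH h] p; rewrite h hM1 -addrA; congr (_ + _).
rewrite -[incidence N p _](sum_indicator (CI p)) -big_split /=.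
by apply: eq_bigr => u _; rewrite !ffunE /= PoszD mulrDr.
Qed.

(** [vle x y] makes the truncated difference exact; it counts the firings still owed between [M1]
    and [M2]. *)
Lemma state_eq_sub (M M1 M2 : marking P) (x y : {ffun implicit -> nat}) :
  state_eq M x M1 -> state_eq M y M2 -> vle x y ->
  state_eq M1 [ffun u => (y u - x u)%N] M2.
Proof.
move=> h1 h2 /forallP le p; rewrite h1 h2 -addrA; congr (_ + _).
rewrite -big_split /=; apply: eq_bigr => u _.
by rewrite ffunE -subzn // -mulrDr addrC subrK.
Qed.

Hypothesis acyc : acyclic (induced_subnet N TI).

(** A source of the support of [y] together with its output places cannot be a place, since each
    such place has a producer in the support. It is thus a transition, and no transition of the
    support feeds its input places. Were it short of tokens at one of them, [M'] would be negative
    there. *)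
Lemma state_eq_enabled (M M' : marking P) (y : {ffun implicit -> nat})
    (t0 : implicit) :
  state_eq M y M' -> (0 < y t0)%N ->
  exists2 t : implicit, (0 < y t)%N & enabled N M (val t).
Proof.
move=> eqM yt0.
(* S: the support of y together with its output places. *)
pose S := [set v : P + implicit | match v with
  | inl p => [exists u, (0 < y u)%N && (0 < Post N p (val u))%N]
  | inr u => (0 < y u)%N end].
have St0 : inr t0 \in S by rewrite inE.
have [x] := ucycle_free_source acyc St0.
case: x => [p|t]; rewrite inE /= => Sx src.
  case/existsP: Sx => u /andP[yu pu].
  by have := src (inr u); rewrite inE /= pu => /(_ yu).
exists t => //; apply: contraT; rewrite negb_forall => /existsP[p].
rewrite ffunE -ltnNge -[sval t]/(val t) => ltp.
(* The arc from [p] to the source [t] forces [p] outside [S]. *)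
have noPost u : (Post N p (val u) * y u = 0)%N.
  apply/eqP; rewrite muln_eq0; apply: contraT; rewrite negb_or -!lt0n.
  case/andP=> pu yu; have := src (inl p); rewrite inE /=.
  have -> : (0 < Pre N p (val t))%N by exact: leq_ltn_trans ltp.
  by move=> h; apply: h; apply/existsP; exists u; rewrite yu.
have sumE : \sum_u CI p u * (y u)%:Z
          = - (\sum_u Pre N p (val u) * y u)%N%:Z.
  rewrite (big_morph Posz PoszD (erefl _)) -sumrN; apply: eq_bigr => u _.
  by rewrite /incidence mulrBl -!PoszM noPost sub0r.
(* Since [y t] is positive, the consumption of [t] alone already exceeds [M p]. *)
have lt_sum : (M p < \sum_u Pre N p (val u) * y u)%N.
  apply: leq_trans ltp _; rewrite (bigD1 t) //=.
  by apply: leq_trans (leq_addr _ _); rewrite leq_pmulr.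
by have := eqM p; rewrite sumE; move: lt_sum; lia.
Qed.

(** Induction on the total count: fire an enabled transition of the support, then realize the
    residual vector. *)
Lemma state_eq_fires (M M' : marking P) (y : {ffun implicit -> nat}) :
  state_eq M y M' ->
  exists s : seq implicit, fires N M (map val s) M' /\ phi s = y.
Proof.
have [n] := ubnP (\sum_u y u)%N.
elim: n M y => // n IH M y ltn eqM.
have [/existsP[t0 yt0]|] := boolP [exists t, (0 < y t)%N]; last first.
  rewrite negb_exists => /forallP y0.
  have {}y0 u : y u = 0%N by have := y0 u; case: (y u).
  exists [::]; split; last by apply/ffunP => u; rewrite ffunE y0.
  apply/ffunP => p; have := eqM p.
  by rewrite big1 ?addr0 => [[]|u _] //; rewrite y0 mulr0.
have [t yt en] := state_eq_enabled eqM yt0.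
have [M1 fM1] := enabled_fires1 en.
have eq1 : state_eq M (phi [:: t]) M1.
  by apply: fires_state_eq; exists M1.
have le1 : vle (phi [:: t]) y.
  apply/forallP => u; rewrite ffunE /= addn0.
  by case: eqP => // <-.
have [|s [fs phis]] := IH M1 _ _ (state_eq_sub eq1 eqM le1).
  move: ltn; rewrite ltnS; apply: leq_trans.
  apply: vle_sum; first by apply/forallP => u; rewrite ffunE leq_subr.
  by move/ffunP/(_ t); rewrite !ffunE /= eqxx; lia.
exists (t :: s); split; first by exists M1.
apply/ffunP => u; have /ffunP/(_ u) := phis.
by have /forallP/(_ u) := le1; rewrite !ffunE /=; lia.
Qed.

(** The descent terminates because a strictly smaller count vector belongs to a shorter word. *)
Lemma Sigma_min_below (M : marking P) (t : T) (s : seq implicit) :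
  Sigma N M t s ->
  exists s', Sigma_min N M t s' /\ vle (phi s') (phi s).
Proof.
have [n] := ubnP (size s); elim: n s => // n IH s ltn Ss.
case: (classic (exists s', [/\ Sigma N M t s', vle (phi s') (phi s)
                             & phi s' <> phi s])) => [[s' [Ss' le ne]]|min].
  have [|s2 [min2 le2]] := IH s' _ Ss'.
    by have := vle_sum le ne; rewrite !sum_phi; lia.
  by exists s2; split=> //; apply: vle_trans le.
by exists s; split=> //; apply: vle_refl.
Qed.

Lemma dead_Sigma_I_max (M M' : marking P) (s : seq implicit) :
  fires N M (map val s) M' -> dead N M' -> Sigma_I_max N M s.
Proof.
move=> fs deadM'; split; first by exists M'.
case=> s' [[M2 fs'] le ne].
have := state_eq_sub (fires_state_eq fs) (fires_state_eq fs') le.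
(* The residual is fired from [M']: an empty word makes the two count vectors equal, a nonempty one
   contradicts deadness. *)
case/state_eq_fires => -[|t r] [/= fr phir].
  apply: ne; apply/ffunP => u; have /ffunP/(_ u) := phir.
  by have /forallP/(_ u) := le; rewrite !ffunE /=; lia.
by case: fr => M3 [[en _] _]; have := deadM' (val t); rewrite en.
Qed.

(** Induction on the last transition [t]. An implicit [t] extends the current word [s]. For an
    explicit [t], a minimal explanation below [s] is fired before it, and the surplus of [s] can be
    fired afterwards because its state equation leads to the marking [M]. *)
Lemma reachable_minimax (TE : {set T}) (M0 M : marking P) :
  TE :|: TI = [set: T] -> reachable N M0 M ->
  exists Mb (s : seq implicit),
    minimax_basis_marking N TE TI M0 Mb /\ fires N Mb (map val s) M.
Proof.
move=> cover [w]; elim/last_ind: w M => [|w t IH] M.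
  by move=> /= ->; exists M0, [::]; split=> //; apply: minimax_init.
case/fires_rcons=> M1 [/IH [Mb [s [bMb fs]]] ft].
have : t \in TE :|: TI by rewrite cover inE.
case/setUP=> tE; last first.
  exists Mb, (rcons s (exist _ t tE)); split=> //.
  by rewrite map_rcons; apply/fires_rcons; exists M1.
have [en eqM] := ft.
have [|s' [min_s' le]] := @Sigma_min_below Mb t s; first by exists M1.
have [[M2 [fs' en2]] _] := min_s'.
have [M3 [_ eqM3]] := enabled_fires1 en2.
have eq2 := fires_state_eq fs'.
have bM3 : minimax_basis_marking N TE TI M0 M3.
  apply: (minimax_step bMb tE (y := phi s')); first by left; exists s'.
  by move=> p; rewrite eqM3 eq2.
have : state_eq M3 [ffun u => (phi s u - phi s' u)%N] M.
  move=> p; rewrite eqM eqM3 (state_eq_sub eq2 (fires_state_eq fs) le).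
  by rewrite addrAC.
case/state_eq_fires => r [fr _].
by exists M3, r.
Qed.

End Implicit.

Theorem proposition6 (P T : finType) (N : petri_net P T) (M0 : marking P)
    (TE TI : {set T}) (hbounded : bounded N M0)
    (hpi : basis_partition N TE TI)
    (M : marking P) (hM : reachable N M0 M) :
  dead N M <->
  exists (Mb : marking P) (s : seq {t : T | t \in TI}),
    [/\ minimax_basis_marking N TE TI M0 Mb,
        Sigma_I_max N Mb s,
        forall t : T, t \in TE -> ~ Sigma_max N Mb t s &
        fires N Mb (map val s) M].
Proof.
case: hpi => cover _ acyc; split=> [deadM|[Mb [s [_ [_ max_s] no_max fs]]] t].
  have [Mb [s [bMb fs]]] := reachable_minimax acyc cover hM.
  exists Mb, s; split=> //; first exact: (dead_Sigma_I_max acyc fs deadM).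
  move=> t _ [[M' [fs' en]] _].
  (* The state equation of [s] determines the final marking, so an explanation of [t] would end at
     [M], where [t] is disabled. *)
  suff MM' : M = M' by have := deadM t; rewrite /enabled MM' en.
  apply/ffunP => p; apply/eqP; rewrite -eqz_nat.
  by rewrite (fires_state_eq fs) (fires_state_eq fs').
apply/negP => en; have : t \in TE :|: TI by rewrite cover inE.
case/setUP=> tE.
  (* An explicit [t] enabled at [M] makes [s] an explanation of [t], and a larger explanation would
     be a larger fireable word. *)
  apply: (no_max t tE); split; first by exists M.
  by case=> s' [[M' [fs' _]] le ne]; apply: max_s; exists s'; split=> //; exists M'.
(* An implicit [t] enabled at [M] could be appended to [s], against its maximality. *)
have [M1 fM1] := enabled_fires1 en.
apply: max_s; exists (rcons s (exist _ t tE)); split.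
- by exists M1; rewrite map_rcons; apply/fires_rcons; exists M.
- by apply/forallP => u; rewrite !ffunE -cats1 count_cat leq_addr.
- move/ffunP/(_ (exist _ t tE)); rewrite !ffunE -cats1 count_cat /= eqxx.
  by lia.
Qed.
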